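(* Consider the SLC problem with $m$ machines and $k$ linear constraints, and let $C^*_{\max}$ be its optimal makespan. The following LP-based algorithm returns a feasible schedule with makespan $C_{\max}=t\le\frac{m}{m-K}C^*_{\max}$. Algorithm: find an optimal basic feasible solution $(\bm{x},t)$ of (LP7): minimize $t$ subject to $A\bm{x}\ge\bm{b}$, $\sum_{i=1}^n x_i\le(m-K)t$, $x_i\le t$ for all $i$, $\bm{x}\ge0$; use $\bm{x}$ as processing times. Let $l$ be the number of jobs with $x_i=t$ and put each of them alone on its own machine. If jobs remain, put the $k+1-m+l$ smallest jobs with $0<x_i<t$ together on a single machine, and put each of the remaining jobs alone on its own machine among the remaining $m-l-1$ machines. Return $\bm{x}$, $C_{\max}=t$ and the schedule.
   Context: The SLC problem: there are $m$ identical parallel machines and $n$ jobs. The processing times $\bm{x}=(x_1,\ldots,x_n)$ are decision variables and must satisfy $A\bm{x}\ge\bm{b}$, $\bm{x}\ge0$, with $A\in\mathbb{R}^{k\times n}$, $\bm{b}\in\mathbb{R}^k$ given. The goal is to choose feasible processing times and an assignment of each job to exactly one machine so as to minimize the makespan (maximum over machines of total processing time assigned). Let $\tilde k=k+1-\sqrt{k}$. Define $K=m-\frac{k}{k+1-m}$ if $\tilde k>m$, and $K=\max\left(\lceil\tilde k\rceil-\frac{k}{k+1-\lceil\tilde k\rceil},\ \lfloor\tilde k\rfloor-\frac{k}{k+1-\lfloor\tilde k\rfloor}\right)$ if $\tilde k\le m$. Basic feasible solutions are with respect to the standard form obtained by adding slack variables.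
   Formalization: With p jobs having 0<x_i<t, the pool takes the k+1-m+l-(k-p) smallest of them (none if negative), as pooling k+1-m+l can exceed t if p<k; the schedule's makespan is shown to be at most t, not equal to t; l counts only jobs with x_i>0; k≥1. *)

(* Defs.v *)
From HB Require Import structures.
From mathcomp Require Import all_boot all_order all_algebra.
From mathcomp Require Import classical_sets reals.
Set Implicit Arguments.
Unset Strict Implicit.
Unset Printing Implicit Defensive.
Import Order.TTheory GRing.Theory Num.Theory.
Local Open Scope ring_scope.

Section SLC.
Variables (R : realType) (k n : nat) (A : 'M[R]_(k, n)) (b : 'cV[R]_k).

Definition SLC_feasible (x : 'cV[R]_n) : Prop :=
  (forall r, b r 0 <= (A *m x) r 0) /\ (forall i, 0 <= x i 0).

(* Loads are nonnegative for feasible x, so the unit 0 of the maximum is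
   harmless. *)
Definition makespan (m : nat) (sigma : 'I_n -> 'I_m) (x : 'cV[R]_n) : R :=
  \big[Num.max/0]_(j < m) \sum_(i | sigma i == j) x i 0.

(* Optimal value; only meaningful when some x is feasible (the set below is
   then nonempty and bounded below by 0, for m > 0). *)
Definition opt_makespan (m : nat) : R :=
  inf [set C | exists x (sigma : 'I_n -> 'I_m),
         SLC_feasible x /\ C = makespan sigma x]%classic.

End SLC.

Section Kconst.
Variable R : realType.

Definition ktilde (k : nat) : R := k%:R + 1 - Num.sqrt k%:R.

Definition Kterm (k : nat) (c : R) : R := c - k%:R / (k%:R + 1 - c).

(* For k > 0 no denominator vanishes: ktilde k <= k, hence so is its ceiling. *)
Definition Kconst (m k : nat) : R :=
  if m%:R < ktilde k then Kterm k m%:R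
  else Num.max (Kterm k (Num.ceil (ktilde k))%:~R)
               (Kterm k (Num.floor (ktilde k))%:~R).

End Kconst.

(* Standard form M y = r, y >= 0: a basis is a choice f of as many columns as
   there are rows, forming an invertible matrix; nonbasic variables vanish. *)
Definition basic_feasible (R : realType) (p q : nat)
    (M : 'M[R]_(p, q)) (r : 'cV[R]_p) (y : 'cV[R]_q) : Prop :=
  [/\ M *m y = r, forall j, 0 <= y j 0
    & exists f : 'I_p -> 'I_q,
        colsub f M \in unitmx /\ forall j, j \notin codom f -> y j 0 = 0].

Section LP7.
Variables (R : realType) (k n : nat) (A : 'M[R]_(k, n)) (b : 'cV[R]_k).
Variable m : nat.

Definition LP7_feasible (x : 'cV[R]_n) (t : R) : Prop :=
  [/\ forall r, b r 0 <= (A *m x) r 0,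
      \sum_i x i 0 <= (m%:R - Kconst R m k) * t,
      forall i, x i 0 <= t
    & forall i, 0 <= x i 0].

Definition LP7_optimal (x : 'cV[R]_n) (t : R) : Prop :=
  LP7_feasible x t /\ forall x' t', LP7_feasible x' t' -> t <= t'.

(* The constraints as  G (x; t) <= h, the first k rows being - A x <= - b. *)
Definition LP7_lhs : 'M[R]_(k + 1 + n, n + 1) :=
  col_mx (col_mx (row_mx (- A) 0)
                 (row_mx (const_mx 1) (const_mx (- (m%:R - Kconst R m k)))))
         (row_mx 1%:M (const_mx (- 1))).

Definition LP7_rhs : 'cV[R]_(k + 1 + n) := col_mx (col_mx (- b) 0) 0.

(* One slack per row. The standard form also makes t nonnegative, which the
   constraints of the program already imply (m - K > 0 when m, k > 0). *)
Definition LP7_std : 'M[R]_(k + 1 + n, n + 1 + (k + 1 + n)) :=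
  row_mx LP7_lhs 1%:M.

Definition LP7_optimal_bfs (x : 'cV[R]_n) (t : R) : Prop :=
  LP7_optimal x t /\
  exists slack : 'cV[R]_(k + 1 + n),
    basic_feasible LP7_std LP7_rhs (col_mx (col_mx x (const_mx t)) slack).

End LP7.

Section Schedule.
Variables (R : realType) (n : nat) (x : 'cV[R]_n) (t : R).

(* Jobs with x_i = t; the condition 0 < x_i only matters when t = 0, in which
   case all jobs have length 0. *)
Definition full_jobs : {set 'I_n} := [set i | (0 < x i 0) && (x i 0 == t)].

Definition frac_jobs : {set 'I_n} := [set i | 0 < x i 0 < t].

(* Jobs of length 0 may be placed on any machine, so they are disregarded. *)
Definition alone (m : nat) (sigma : 'I_n -> 'I_m) (i : 'I_n) : Prop :=
  forall i', 0 < x i' 0 -> sigma i' = sigma i -> i' = i.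

(* Number of jobs sharing a machine: the k + 1 - m + l smallest ones (l the
   number of full jobs) in a list of k fractional jobs. A basic solution has at
   most k of them; if it has fewer, the k - #|frac_jobs| missing entries count
   as jobs of length 0, and being the smallest they are among those
   k + 1 - m + l. So all but the m - l - 1 largest fractional jobs are pooled;
   without this correction the pool can be longer than t. The subtractions are
   truncated. *)
Definition pool_size (m k : nat) : nat :=
  ((k + 1 + #|full_jobs|) - m - (k - #|frac_jobs|))%N.

Definition LP_schedule (m k : nat) (sigma : 'I_n -> 'I_m) : Prop :=
  (forall i, i \in full_jobs -> alone sigma i) /\
  ((0 < #|frac_jobs|)%N ->
   exists (P : {set 'I_n}) (j0 : 'I_m),
     [/\ P \subset frac_jobs /\ #|P| = pool_size m k,
         forall i i', i \in P -> i' \in frac_jobs :\: P -> x i 0 <= x i' 0,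
         forall i, i \in P -> sigma i = j0,
         forall i, i \in full_jobs -> sigma i <> j0
       & forall i, i \in frac_jobs :\: P -> sigma i <> j0 /\ alone sigma i]).

End Schedule.

(* Main.v *)
(* Every optimal schedule x', C of SLC gives the point (x', m C / (m - K)) of
   (LP7), which yields the approximation ratio since 0 <= K < m. A basic solution
   has at most k + 1 + n nonzero coordinates; t and, for each job i, one of x_i and
   t - x_i take n + 1 of them, so at most k jobs are fractional. With l full jobs
   and f fractional ones, pooling the 1 + l + f - m smallest fractional jobs is
   safe by averaging as soon as c - K <= k / (k + 1 - c) for c = m - l, that is,
   as soon as K dominates c - k / (k + 1 - c) for all integers 1 <= c <= min(m, k);
   this concave function of c peaks at k + 1 - sqrt k, whence the choice of K. *)
Require Import Defs.
From HB Require Import structures.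
From mathcomp Require Import all_boot all_order all_algebra.
From mathcomp Require Import classical_sets reals.
From mathcomp Require Import boolp.
(* classical_sets shadows the lemmas of finset. *)
From mathcomp Require Import fintype finset.
From mathcomp Require Import ring lra zify.
Set Implicit Arguments.
Unset Strict Implicit.
Unset Printing Implicit Defensive.
Import Order.TTheory GRing.Theory Num.Theory.
Local Open Scope ring_scope.

(** * The constant K *)

Section KconstTheory.
Variable R : realType.
Implicit Types (m k : nat) (a c : R).

(** Since k + 1 - [ktilde] = sqrt k, the factor (k + 1 - a)(k + 1 - c) - k is nonnegative when a and
    c both lie left of [ktilde] and nonpositive when both lie right of it. Monotonicity on either
    side follows without derivatives. *)
Lemma KtermB k a c : a < k%:R + 1 -> c < k%:R + 1 ->
  Kterm k c - Kterm k a =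
  (c - a) * ((k%:R + 1 - a) * (k%:R + 1 - c) - k%:R)
    / ((k%:R + 1 - a) * (k%:R + 1 - c)).
Proof.
move=> ha hc; rewrite /Kterm; field.
by rewrite !subr_eq0 (gt_eqF ha) (gt_eqF hc).
Qed.

Lemma ler_Kterm k a c : a <= c -> c <= ktilde R k -> (0 < k)%N ->
  Kterm k a <= Kterm k c.
Proof.
rewrite /ktilde => ac ck k0.
have s0 : 0 < Num.sqrt (k%:R : R) by rewrite sqrtr_gt0 ltr0n.
have s2 : Num.sqrt (k%:R : R) ^+ 2 = k%:R by rewrite sqr_sqrtr ?ler0n.
have u0 : 0 < k%:R + 1 - c by lra.
have v0 : 0 < k%:R + 1 - a by lra.
rewrite -subr_ge0 KtermB; [|lra|lra].
apply: divr_ge0; last by apply: mulr_ge0; exact: ltW.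
by apply: mulr_ge0; rewrite subr_ge0 // -s2 expr2; apply: ler_pM; lra.
Qed.

Lemma ger_Kterm k a c : ktilde R k <= a -> a <= c -> c < k%:R + 1 ->
  Kterm k c <= Kterm k a.
Proof.
rewrite /ktilde => ka ac ck.
have s2 : Num.sqrt (k%:R : R) ^+ 2 = k%:R by rewrite sqr_sqrtr ?ler0n.
have u0 : 0 < k%:R + 1 - c by lra.
have v0 : 0 < k%:R + 1 - a by lra.
rewrite -subr_le0 KtermB; [|lra|lra].
rewrite -oppr_ge0 -mulNr -mulrN.
apply: divr_ge0; last by apply: mulr_ge0; exact: ltW.
by apply: mulr_ge0; rewrite ?subr_ge0 // opprB subr_ge0 -s2 expr2; apply: ler_pM; lra.
Qed.

Lemma ktilde_le k : (0 < k)%N -> ktilde R k <= k%:R.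
Proof.
move=> k0; have s1 : 1 <= Num.sqrt (k%:R : R).
  by rewrite -[leLHS]sqrtr1 ler_wsqrtr // ler1n.
by rewrite /ktilde; lra.
Qed.

Lemma Kterm_lt k c : (0 < k)%N -> c <= k%:R -> Kterm k c < c.
Proof.
by move=> k0 ck; rewrite /Kterm ltrBlDr ltrDl divr_gt0 ?ltr0n //; lra.
Qed.

(** An integer left of [ktilde] is at most its floor, one right of it at least its ceiling, and
    [Kterm] rises up to [ktilde] and falls after it. If m < [ktilde], the largest candidate c = m
    wins. *)
Lemma Kconst_ge m k (c : nat) : (0 < k)%N -> (c <= m)%N -> (c <= k)%N ->
  Kterm k c%:R <= Kconst R m k.
Proof.
move=> k0 cm ck; rewrite /Kconst; case: (ltP m%:R (ktilde R k)) => mk.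
  by apply: ler_Kterm => //; [rewrite ler_nat | exact: ltW].
rewrite le_max; case: (lerP c%:R (ktilde R k)) => hc; apply/orP; [right|left].
  apply: ler_Kterm => //; last exact: floor_le.
  by rewrite -[c%:R]/((Posz c)%:~R) ler_int floor_ge_int.
apply: ger_Kterm; first exact: ceil_ge.
  by rewrite -[c%:R]/((Posz c)%:~R) ler_int ceil_le_int // ltW.
by rewrite ltr_pwDr // ler_nat.
Qed.

Lemma Kconst_ge0 m k : (0 < m)%N -> (0 < k)%N -> 0 <= Kconst R m k.
Proof.
(* Take c = 1, where [Kterm] is 1 - k / k = 0. *)
move=> m0 k0; apply: le_trans (Kconst_ge k0 m0 k0).
by rewrite /Kterm addrK divff ?subrr // pnatr_eq0 -lt0n.
Qed.

Lemma Kconst_lt m k : (0 < k)%N -> Kconst R m k < m%:R.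
Proof.
move=> k0; have tk := ktilde_le k0; rewrite /Kconst.
case: (ltP m%:R (ktilde R k)) => mk.
  by apply: Kterm_lt => //; lra.
have cm : (Num.ceil (ktilde R k))%:~R <= m%:R :> R.
  by rewrite -[m%:R]/((Posz m)%:~R) ler_int ceil_le_int.
have ck : (Num.ceil (ktilde R k))%:~R <= k%:R :> R.
  by rewrite -[k%:R]/((Posz k)%:~R) ler_int ceil_le_int.
have fk : (Num.floor (ktilde R k))%:~R <= ktilde R k := floor_le _.
rewrite gt_max (lt_le_trans (Kterm_lt k0 ck) cm) /=.
by have := Kterm_lt k0 (le_trans fk tk); lra.
Qed.

End KconstTheory.

(** * Optimal basic solutions of linear programs *)

Section BasicSolutions.
Variables (R : realType) (p q : nat) (M : 'M[R]_(p, q)).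
Implicit Types (y d : 'cV[R]_q) (B S : {set 'I_q}).

Definition supp y : {set 'I_q} := [set j | y j 0 != 0].

(** Linear independence of the columns in S, phrased with kernel vectors of M so that S need not be
    enumerated. *)
Definition indep_cols S : Prop :=
  forall d, M *m d = 0 -> supp d \subset S -> d = 0.

Lemma supp_out y S j : supp y \subset S -> j \notin S -> y j 0 = 0.
Proof.
by move=> /subsetP sS jS; apply/eqP; apply: contraNT jS => yj; rewrite sS ?inE.
Qed.

(** For injective f, multiplication by [colsub f 1%:M] is extension by zero along f, with [rowsub f]
    as the matching restriction. *)
Lemma colsub1_out r (f : 'I_r -> 'I_q) s (z : 'M[R]_(r, s)) j i :
  j \notin codom f -> (colsub f 1%:M *m z) j i = 0.
Proof.
move=> jf; rewrite mxE big1 // => l _; rewrite !mxE.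
by case: eqP => [jE|_]; [rewrite jE codom_f in jf | rewrite mul0r].
Qed.

Lemma colsub1_in r (f : 'I_r -> 'I_q) s (z : 'M[R]_(r, s)) l i :
  injective f -> (colsub f 1%:M *m z) (f l) i = z l i.
Proof.
move=> fI; rewrite mxE (bigD1 l) //= big1 => [|l' ll']; rewrite !mxE.
  by rewrite eqxx mul1r addr0.
by rewrite (inj_eq fI) eq_sym (negPf ll') mul0r.
Qed.

Lemma colsub1_rowsub r (f : 'I_r -> 'I_q) s (y : 'M[R]_(q, s)) :
  injective f -> (forall j i, j \notin codom f -> y j i = 0) ->
  colsub f 1%:M *m rowsub f y = y.
Proof.
move=> fI yf; apply/matrixP => j i.
have [/codomP[l ->]|jf] := boolP (j \in codom f); first by rewrite colsub1_in // mxE.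
by rewrite colsub1_out // yf.
Qed.

Lemma mul_colsub1 r (f : 'I_r -> 'I_q) s (z : 'M[R]_(r, s)) :
  M *m (colsub f 1%:M *m z) = colsub f M *m z.
Proof. by rewrite mulmxA mulmx_colsub mulmx1. Qed.

Lemma colsub_unit_inj (f : 'I_p -> 'I_q) : colsub f M \in unitmx -> injective f.
Proof.
move=> fU i i' fii'; apply/eqP; apply: contraTT isT => ne.
have : colsub f M *m (delta_mx i 0 - delta_mx i' 0 : 'cV_p) = 0.
  rewrite mulmxBr -!colE; apply/colP => l; rewrite !mxE fii'.
  exact: subrr.
move/(congr1 (mulmx (invmx (colsub f M)))); rewrite mulKmx // mulmx0.
move/colP/(_ i); rewrite !mxE !eqxx (negPf ne) /= subr0 => /eqP.
by rewrite oner_eq0.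
Qed.

(** A kernel vector of the submatrix, extended by zero, is a kernel vector of M supported in S,
    hence zero. The transpose appears because [kermx] is a left kernel. *)
Lemma indep_rank r (g : 'I_r -> 'I_q) S : injective g -> indep_cols S ->
  (forall l, g l \in S) -> \rank (colsub g M) = r.
Proof.
move=> gI iS gS; rewrite -mxrank_tr; apply/eqP; rewrite -/(row_free _) -kermx_eq0.
apply/eqP/row_matrixP => i; rewrite row0; apply: trmx_inj; rewrite trmx0.
set v := (row i _)^T.
have vker : colsub g M *m v = 0.
  by rewrite -[colsub g M]trmxK -trmx_mul -row_mul mulmx_ker row0 trmx0.
have v0 : colsub g 1%:M *m v = 0.
  apply: iS; first by rewrite mul_colsub1.
  apply/subsetP => j; rewrite inE => jv.
  have /codomP[l ->] : j \in codom g; last exact: gS.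
  by apply: contraNT jv => jg; rewrite colsub1_out.
by apply/colP => l; rewrite -(colsub1_in v l 0 gI) v0 !mxE.
Qed.

(** A maximal independent B containing S spans all columns, so M factors through the columns in B
    and p <= #|B|; independence gives #|B| <= p. An enumeration of B is then the basis. *)
Lemma indep_extend S : \rank M = p -> indep_cols S ->
  exists f : 'I_p -> 'I_q, colsub f M \in unitmx /\ S \subset codom f.
Proof.
move=> rkM iS.
have [B /maxsetP[/asboolP iB maxB] SB] :
    {B | maxset (fun B => `[< indep_cols B >]) B & S \subset B}.
  by apply: maxset_exists; apply/asboolP.
have span j : exists d, supp d \subset B /\ M *m d = col j M.
  have [jB|jB] := boolP (j \in B).
    exists (delta_mx j 0); rewrite -colE; split=> //.
    apply/subsetP => i; rewrite !inE mxE.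
    by case: (i =P j) => [->|_]; rewrite //= eqxx.
  have : ~ indep_cols (j |: B).
    move=> /asboolP iJ; move: jB; rewrite -(maxB _ iJ (subsetUr _ _)).
    by rewrite setU11.
  move=> /existsNP[d /not_implyP[Md /not_implyP[sd dN0]]].
  have dB i : i != j -> i \notin B -> d i 0 = 0.
    by move=> ij iB'; apply: (supp_out sd); rewrite !inE negb_or ij.
  have dj : d j 0 != 0.
    apply/eqP => dj; apply: dN0; apply: iB => //; apply/subsetP => i.
    rewrite inE; apply: contraNT => iB'; apply/eqP.
    by have [->//|ij] := eqVneq i j; exact: dB.
  (* By maximality column j depends on B through d, with nonzero coefficient at j; solving for that
     column cancels coordinate j. *)
  exists (delta_mx j 0 - (d j 0)^-1 *: d); split; last first.
    by rewrite mulmxBr -scalemxAr Md scaler0 subr0 colE.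
  apply/subsetP => i; rewrite inE; apply: contraNT => iB'; rewrite !mxE.
  have [->|ij] := eqVneq i j; first by rewrite eqxx /= mulVf // subrr.
  by rewrite /= (dB i) // mulr0 subr0.
have [Z /all_and2[ZB MZ]] := choice span.
pose D := \matrix_(i, j) Z j i 0.
have MD : M *m D = M.
  apply/matrixP => i j; have /colP/(_ i) := MZ j; rewrite !mxE => <-.
  by apply: eq_bigr => l _; rewrite mxE.
have evI : injective (@enum_val _ (mem B)) := enum_val_inj.
have rkB := indep_rank evI iB (@enum_valP _ (mem B)).
have cB : #|B| = p.
  apply/eqP; rewrite eqn_leq; apply/andP; split.
    by rewrite -{1}rkB; apply: rank_leq_row.
  rewrite -{1}rkM -MD -[D](colsub1_rowsub evI) ?mul_colsub1.
    by apply: leq_trans (mxrankM_maxl _ _) _; apply: rank_leq_col.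
  move=> j i jB; rewrite mxE; apply: (supp_out (ZB i)).
  apply: contraNN jB => jB; apply/codomP.
  by exists (enum_rank_in jB j); rewrite enum_rankK_in.
pose f (i : 'I_p) := enum_val (cast_ord (esym cB) i).
have fI : injective f by move=> i i' /evI /cast_ord_inj.
exists f; split.
  rewrite -row_free_unit /row_free; apply/eqP.
  by apply: (indep_rank fI iB) => l; apply: enum_valP.
apply/subsetP => j /(subsetP SB) jB; apply/codomP.
exists (cast_ord cB (enum_rank_in jB j)).
by rewrite /f cast_ordK enum_rankK_in.
Qed.

Lemma basic_supp_card r y : basic_feasible M r y -> (#|supp y| <= p)%N.
Proof.
case=> _ _ [f [_ yf]]; rewrite -[leqRHS](card_ord p).
apply: leq_trans (leq_image_card f 'I_p); apply: subset_leq_card.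
by apply/subsetP => j; rewrite inE; apply: contraR => jf; apply/eqP/yf.
Qed.

(** * Descent to basic solutions under an objective bounded below *)

Variables (r : 'cV[R]_p) (c : 'rV[R]_q) (lb : R).
Hypothesis M_full : \rank M = p.
Hypothesis c_lb : forall y, M *m y = r -> (forall j, 0 <= y j 0) ->
  lb <= (c *m y) 0 0.

(* A kernel vector supported in supp y can be followed downhill; the lower bound
   forces it to leave the orthant, where a coordinate of y is lost. *)
Lemma supp_reduce y : M *m y = r -> (forall j, 0 <= y j 0) ->
  ~ indep_cols (supp y) ->
  exists y', [/\ M *m y' = r, forall j, 0 <= y' j 0,
    (c *m y') 0 0 <= (c *m y) 0 0 & (#|supp y'| < #|supp y|)%N].
Proof.
move=> My y0 /existsNP[d0 /not_implyP[Md0 /not_implyP[sd0 d0N0]]].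
have cost d s : (c *m (y + s *: d)) 0 0 = (c *m y) 0 0 + s * (c *m d) 0 0.
  by rewrite mulmxDr -scalemxAr !mxE.
have feas d s : M *m d = 0 -> M *m (y + s *: d) = r.
  by move=> Md; rewrite mulmxDr -scalemxAr Md scaler0 addr0.
(* One sign of [d0] does not increase the cost. If that direction has no negative coordinate, its
   ray stays feasible, so its cost is zero and the opposite direction serves. *)
have [d [Md sd cd [j0 dj0]]] : exists d, [/\ M *m d = 0, supp d \subset supp y,
    (c *m d) 0 0 <= 0 & exists j, d j 0 < 0].
  have [d [Md sd cd dN0]] : exists d, [/\ M *m d = 0, supp d \subset supp y,
      (c *m d) 0 0 <= 0 & d != 0].
    have [cd|cd] := lerP ((c *m d0) 0 0) 0.
      by exists d0; split=> //; apply/eqP.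
    exists (- d0); split; rewrite ?mulmxN ?Md0 ?oppr0 ?oppr_eq0 //; last first.
    - exact/eqP.
    - by rewrite mxE oppr_le0 ltW.
    by apply: subset_trans sd0; apply/subsetP => j; rewrite !inE mxE oppr_eq0.
  have [[j dj]|dN] := pselect (exists j, d j 0 < 0); first by
    exists d; split=> //; exists j.
  have dge j : 0 <= d j 0 by rewrite leNgt; apply/negP => dj; apply: dN; exists j.
  have cd0 : (c *m d) 0 0 = 0.
    apply/eqP; rewrite eq_le cd /= leNgt; apply/negP => cneg.
    (* This step length would bring the cost down to lb - 1. *)
    pose s := ((c *m y) 0 0 - lb + 1) / - (c *m d) 0 0.
    have s0 : 0 <= s.
      apply: divr_ge0; last by rewrite oppr_ge0.
      by have := c_lb My y0; lra.
    have := c_lb (feas d s Md) _; rewrite cost.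
    have -> : s * (c *m d) 0 0 = - ((c *m y) 0 0 - lb + 1).
      by rewrite /s; field; rewrite lt_eqF.
    move=> H; suff : lb <= (c *m y) 0 0 + - ((c *m y) 0 0 - lb + 1) by lra.
    by apply: H => j; rewrite !mxE addr_ge0 // mulr_ge0.
  exists (- d); split.
  - by rewrite mulmxN Md oppr0.
  - by apply: subset_trans sd; apply/subsetP => j; rewrite !inE mxE oppr_eq0.
  - by rewrite mulmxN mxE cd0 oppr0.
  have [j dj] : exists j, d j 0 != 0.
    apply/existsP; rewrite -negb_forall; apply: contraNN dN0 => /forallP dz.
    by apply/eqP/colP => j; rewrite mxE; apply/eqP.
  by exists j; rewrite mxE oppr_lt0 lt_neqAle eq_sym dj dge.
(* Ratio test: the smallest y_j / - d_j over the negative d_j is the largest step that keeps y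
   nonnegative, and it makes the minimizing coordinate vanish. *)
have [j dj jmin] :=
  @arg_minP _ _ _ j0 (fun j => d j 0 < 0) (fun j => y j 0 / - d j 0) dj0.
set s := y j 0 / - d j 0 in jmin.
have s0 : 0 <= s by rewrite divr_ge0 // oppr_ge0 ltW.
exists (y + s *: d); split; first exact: feas.
- move=> i; rewrite !mxE; have [di|di] := lerP 0 (d i 0).
    by rewrite addr_ge0 // mulr_ge0.
  have := jmin i di; rewrite ler_pdivlMr ?oppr_gt0 // mulrN.
  by rewrite -subr_ge0 opprK.
- by rewrite cost gerDl mulr_ge0_le0.
apply: proper_card; apply/properP; split.
  apply/subsetP => i; rewrite inE; apply: contraNT => iy.
  by rewrite !mxE (supp_out sd iy) mulr0 addr0; move: iy; rewrite inE negbK.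
exists j; first by apply: (subsetP sd); rewrite inE lt_eqF.
by rewrite inE negbK !mxE /s invrN mulrN mulNr mulfVK ?subrr // lt_eqF.
Qed.

(** Induction on the size of the support: a dependent support shrinks, an independent one extends to
    a basis. *)
Lemma basic_reduce y : M *m y = r -> (forall j, 0 <= y j 0) ->
  exists y', basic_feasible M r y' /\ (c *m y') 0 0 <= (c *m y) 0 0.
Proof.
have [N] := ubnP #|supp y|; elim: N y => // N IH y leN My y0.
have [iy|niy] := pselect (indep_cols (supp y)).
  exists y; split=> //; split=> //.
  have [f [fU sf]] := indep_extend M_full iy.
  exists f; split=> // j jf; apply/eqP; apply: contraNT jf => yj.
  by apply: (subsetP sf); rewrite inE.
have [y' [My' y'0 cy' ly']] := supp_reduce My y0 niy.
have [|y'' [by'' cy'']] := IH y' _ My' y'0; first exact: leq_trans ly' _.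
by exists y''; split=> //; exact: le_trans cy'' cy'.
Qed.

(** The solution determined by the basis f. Finite functions make the candidate bases a finite type,
    over which a minimum exists. *)
Let bsol (f : {ffun 'I_p -> 'I_q}) : 'cV[R]_q :=
  colsub f 1%:M *m (invmx (colsub f M) *m r).

Lemma basic_bsol y : basic_feasible M r y ->
  exists f : {ffun 'I_p -> 'I_q}, colsub f M \in unitmx /\ y = bsol f.
Proof.
case=> My _ [f [fU yf]].
have fE : finfun f =1 f by move=> i; rewrite ffunE.
exists (finfun f); rewrite /bsol !(eq_colsub _ fE); split=> //.
have {1}<- : colsub f 1%:M *m rowsub f y = y.
  apply: colsub1_rowsub; first exact: colsub_unit_inj.
  by move=> j i jf; rewrite ord1 yf.
congr (_ *m _); rewrite -My -{2}[y](@colsub1_rowsub _ f) ?mul_colsub1 ?mulKmx //.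
  exact: colsub_unit_inj.
by move=> j i jf; rewrite ord1 yf.
Qed.

(** No compactness is involved: every feasible point is dominated by a basic one, and the cheapest
    of the finitely many feasible [bsol f] is optimal. *)
Theorem exists_optimal_basic : (exists y, M *m y = r /\ forall j, 0 <= y j 0) ->
  exists y, basic_feasible M r y /\
    forall y', M *m y' = r -> (forall j, 0 <= y' j 0) ->
      (c *m y) 0 0 <= (c *m y') 0 0.
Proof.
case=> y0 [My0 y0ge].
pose P (f : {ffun 'I_p -> 'I_q}) :=
  (colsub f M \in unitmx) && [forall j, 0 <= bsol f j 0].
have basicP y : basic_feasible M r y -> exists2 f, P f & y = bsol f.
  move=> yb; have [f [fU yE]] := basic_bsol yb; exists f => //.
  by rewrite /P fU -yE; apply/forallP; case: yb.
have [y1 [/basicP[f0 Pf0 _] _]] := basic_reduce My0 y0ge.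
have [f /andP[fU /forallP fge] fmin] :=
  @arg_minP _ _ _ f0 P (fun f => (c *m bsol f) 0 0) Pf0.
exists (bsol f); split.
  split=> //; first by rewrite /bsol mul_colsub1 mulKVmx.
  by exists f; split=> // j jf; rewrite /bsol colsub1_out.
move=> y My yge; have [y' [/basicP[f' Pf' ->]]] := basic_reduce My yge.
exact/le_trans/fmin.
Qed.

End BasicSolutions.

(** * The program (LP7) *)

Section LP7Theory.
Variables (R : realType) (k n : nat) (A : 'M[R]_(k, n)) (b : 'cV[R]_k).
Variable m : nat.
Implicit Types (x : 'cV[R]_n) (t : R).

Lemma LP7_lhsE x t :
  LP7_lhs A m *m col_mx x (const_mx t) =
  col_mx (col_mx (- (A *m x))
                 (const_mx (\sum_i x i 0 - (m%:R - Kconst R m k) * t)))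
         (x - const_mx t).
Proof.
rewrite /LP7_lhs !mul_col_mx !mul_row_col mulNmx mul0mx addr0 mul1mx.
congr (col_mx (col_mx _ _) _).
  apply/matrixP => i j; rewrite !mxE big_ord1 !mxE mulNr; congr (_ - _).
  by apply: eq_bigr => l _; rewrite mxE mul1r ord1.
by congr (_ + _); apply/matrixP => i j; rewrite !mxE big_ord1 !mxE mulN1r.
Qed.

Lemma LP7_feasibleP x t : LP7_feasible A b m x t <->
  (forall i, (LP7_lhs A m *m col_mx x (const_mx t)) i 0 <= LP7_rhs n b i 0) /\
  (forall i, 0 <= x i 0).
Proof.
rewrite LP7_lhsE /LP7_rhs; split=> [[bA sx xt x0]|[H x0]].
  split=> // i; case: (split_ordP i) => [i' ->|i' ->].
    rewrite !col_mxEu; case: (split_ordP i') => [i1 ->|i1 ->].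
      by rewrite !col_mxEu !mxE lerN2; have := bA i1; rewrite mxE.
    by rewrite !col_mxEd !mxE subr_le0.
  by rewrite !col_mxEd !mxE subr_le0.
split=> // [r| |i].
- by have := H (lshift n (lshift 1 r)); rewrite !col_mxEu !mxE lerN2.
- by have := H (lshift n (rshift k 0)); rewrite !col_mxEu !col_mxEd !mxE subr_le0.
- by have := H (rshift (k + 1) i); rewrite !col_mxEd !mxE subr_le0.
Qed.

Lemma LP7_stdE (z : 'cV[R]_(n + 1)) s :
  (LP7_std A m *m col_mx z s = LP7_rhs n b) <->
  s = LP7_rhs n b - LP7_lhs A m *m z.
Proof.
rewrite /LP7_std mul_row_col mul1mx; split=> [<-|->]; first by rewrite addrC addKr.
by rewrite addrC subrK.
Qed.

Lemma LP7_std_rank : \rank (LP7_std A m) = (k + 1 + n)%N.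
Proof.
apply/eqP; rewrite eqn_leq rank_leq_row /=.
(* The slack columns form an identity block, which gives a right inverse. *)
have I : LP7_std A m *m col_mx 0 1%:M = 1%:M :> 'M[R]_(k + 1 + n).
  by rewrite /LP7_std mul_row_col mulmx0 add0r mulmx1.
by rewrite -[leqLHS](mxrank1 R) -I mxrankM_maxl.
Qed.

Lemma frac_jobs_card x t : LP7_optimal_bfs A b m x t -> (#|frac_jobs x t| <= k)%N.
Proof.
case=> -[xtf _] [s sb]; have [_ _ xt x0] := xtf.
have [->|[i0 i0f]] := set_0Vmem (frac_jobs x t); first by rewrite cards0.
have t0 : 0 < t by move: i0f; rewrite inE => /andP[]; exact: lt_trans.
have sE i : s (rshift (k + 1) i) 0 = t - x i 0.
  have [/LP7_stdE -> _ _] := sb.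
  by rewrite LP7_lhsE mxE [X in _ + X]mxE /LP7_rhs !col_mxEd !mxE add0r opprB.
have := basic_supp_card sb.
rewrite /supp cardsE -sum1_card big_mkcond !big_split_ord /= big_ord1.
under eq_bigr do rewrite unfold_in /= !col_mxEu.
rewrite !unfold_in /= col_mxEu col_mxEd mxE gt_eqF //=.
under [X in (_ + (_ + X))%N]eq_bigr do rewrite unfold_in /= !col_mxEd sE.
set a := (\sum_(i < n) _)%N; set c := (\sum_(i < n) _)%N.
set d := (X in (_ + (X + _))%N).
move=> H.
(* Here a counts the nonzero x_i and c the nonzero slacks t - x_i, while t > 0 takes one more
   coordinate. Every job contributes to a or c, and a fractional job to both. *)
suff : (n + #|frac_jobs x t| <= a + c)%N.
  by move: H; move: a c d #|frac_jobs x t| => a c d f; lia.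
rewrite /a /c -big_split /= -{1}(card_ord n) -sum1_card.
rewrite -sum1_card [X in (_ + X)%N]big_mkcond -big_split /=.
apply: leq_sum => i _; rewrite inE subr_eq0 !lt_neqAle xt x0 !andbT.
rewrite [t == _]eq_sym [0 == _]eq_sym.
by case: (eqVneq (x i 0) 0) => [->|_];
  rewrite ?[0 == t]eq_sym ?(gt_eqF t0) //=; case: eqP.
Qed.

(** * Existence of optimal basic solutions and comparison with the optimal makespan *)

Hypotheses (m_gt0 : (0 < m)%N) (k_gt0 : (0 < k)%N).

Lemma LP7_feasible_t_ge0 x t : LP7_feasible A b m x t -> 0 <= t.
Proof.
case=> _ sx _ x0; have K := Kconst_lt R m k_gt0.
rewrite -(@pmulr_rge0 _ (m%:R - Kconst R m k)) ?subr_gt0 //.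
by apply: le_trans sx; apply: sumr_ge0.
Qed.

Lemma LP7_std_feasible x t : LP7_feasible A b m x t ->
  exists s, LP7_std A m *m col_mx (col_mx x (const_mx t : 'cV_1)) s = LP7_rhs n b /\
    forall j, 0 <= col_mx (col_mx x (const_mx t : 'cV_1)) s j 0.
Proof.
move=> xt; have t0 := LP7_feasible_t_ge0 xt.
have [H x0] := (LP7_feasibleP x t).1 xt.
exists (LP7_rhs n b - LP7_lhs A m *m col_mx x (const_mx t)).
split=> [|j]; first by apply/LP7_stdE.
case: (split_ordP j) => [j' ->|j' ->].
  rewrite col_mxEu; case: (split_ordP j') => [i ->|i ->].
    by rewrite col_mxEu.
  by rewrite col_mxEd mxE.
by rewrite col_mxEd mxE [X in _ + X]mxE subr_ge0.
Qed.

(** Scaling t by m / (m - K) turns the volume bound (m - K) t into m t; as this factor is at least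
    1, the bounds x_i <= t only loosen. *)
Lemma SLC_LP7_feasible x t : SLC_feasible A b x -> \sum_i x i 0 <= m%:R * t ->
  (forall i, x i 0 <= t) -> 0 <= t ->
  LP7_feasible A b m x (m%:R / (m%:R - Kconst R m k) * t).
Proof.
move=> [Ax x0] sx xt t0; have K := Kconst_lt R m k_gt0.
have K0 := Kconst_ge0 R m_gt0 k_gt0.
split=> // [|i].
  by rewrite mulrCA mulrA divfK // subr_eq0 gt_eqF.
apply: le_trans (xt i) _; rewrite ler_peMl // ler_pdivlMr ?subr_gt0 //.
by rewrite mul1r; lra.
Qed.

Lemma exists_LP7_optimal_bfs : (exists x, SLC_feasible A b x) ->
  exists x t, LP7_optimal_bfs A b m x t.
Proof.
move=> [x0 fx0].
pose S := \sum_i x0 i 0.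
have x0S i : x0 i 0 <= S.
  rewrite /S (bigD1 i) //= lerDl; apply: sumr_ge0 => j _; exact: fx0.2.
have S0 : 0 <= S by apply: sumr_ge0 => j _; exact: fx0.2.
(* The total length S is a valid t: it bounds each job, and S <= m S. *)
have [|s [Hs Hs0]] := LP7_std_feasible (@SLC_LP7_feasible x0 S fx0 _ x0S S0).
  by rewrite ler_peMl // ler1n.
pose tix : 'I_(n + 1 + (k + 1 + n)) := lshift _ (rshift n 0).
have costE y : ((delta_mx 0 tix : 'rV[R]__) *m y) 0 0 = y tix 0.
  by rewrite -rowE mxE.
have [||y [yb ymin]] := @exists_optimal_basic _ _ _ (LP7_std A m) (LP7_rhs n b)
    (delta_mx 0 tix) 0 LP7_std_rank.
- by move=> y _ y0; rewrite costE.
- by eexists; split; [exact: Hs | exact: Hs0].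
pose x := usubmx (usubmx y); pose t := y tix 0; pose sl := dsubmx y.
have yE : y = col_mx (col_mx x (const_mx t : 'cV_1)) sl.
  rewrite -[y]vsubmxK; congr (col_mx _ _); rewrite -[LHS]vsubmxK; congr (col_mx _ _).
  by apply/matrixP => i j; rewrite !mxE !ord1.
have [yeq y0 _] := yb.
exists x, t; split; last by exists sl; rewrite -yE.
split.
  apply/LP7_feasibleP; split=> i; last first.
    by have := y0 (lshift _ (lshift _ i)); rewrite yE !col_mxEu.
  have := y0 (rshift _ i); move: yeq; rewrite yE => /LP7_stdE ->.
  by rewrite col_mxEd mxE [X in _ + X]mxE subr_ge0.
move=> x' t' xt'; have [s' [H1 H2]] := LP7_std_feasible xt'.
have := ymin _ H1 H2; rewrite !costE {2}/tix col_mxEu col_mxEd mxE.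
exact: id.
Qed.

Lemma LP7_optimal_le x t : LP7_optimal A b m x t -> (exists x, SLC_feasible A b x) ->
  t <= m%:R / (m%:R - Kconst R m k) * opt_makespan A b m.
Proof.
move=> [_ tmin] [x1 fx1]; have K := Kconst_lt R m k_gt0.
have m0 : (0 : R) < m%:R by rewrite ltr0n.
rewrite -[leRHS]mulrC -ler_pdivrMr; last by rewrite divr_gt0 ?subr_gt0.
apply: lb_le_inf.
  (* [lb_le_inf] asks for a nonempty set: put all jobs on one machine. *)
  exists (makespan (fun _ => Ordinal m_gt0) x1), x1, (fun _ => Ordinal m_gt0).
  by split.
move=> _ [x' [sigma [fx' ->]]].
rewrite ler_pdivrMr; last by rewrite divr_gt0 ?subr_gt0.
rewrite mulrC; have x'0 := fx'.2.
have load j : \sum_(i | sigma i == j) x' i 0 <= makespan sigma x' by apply: le_bigmax.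
apply: (tmin x'); apply: SLC_LP7_feasible => //.
- rewrite (partition_big sigma xpredT) //=.
  apply: le_trans (ler_sum _ (fun j _ => load j)) _.
  by rewrite sumr_const card_ord mulr_natl.
- move=> i; apply: le_trans (load (sigma i)); rewrite (bigD1 i) //= lerDl.
  exact: sumr_ge0.
- by apply: le_trans (load (Ordinal m_gt0)); apply: sumr_ge0.
Qed.

End LP7Theory.

(** * Schedules from basic solutions *)

Section Smallest.
Variables (R : realType) (T : finType) (w : T -> R) (F : {set T}).

Lemma exists_smallest p : (p <= #|F|)%N -> exists P : {set T},
  [/\ P \subset F, #|P| = p
    & forall i i', i \in P -> i' \in F :\: P -> w i <= w i'].
Proof.
elim: p => [_|p IH pF].
  by exists set0; split; rewrite ?sub0set ?cards0 // => i i'; rewrite inE.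
have [P [PF cP Ple]] := IH (ltnW pF).
have [i0 i0F] : exists i, i \in F :\: P.
  by apply/set0Pn; rewrite -card_gt0 cardsD (setIidPr PF) cP subn_gt0.
have [i iF imin] := @arg_minP _ _ _ i0 (fun i => i \in F :\: P) w i0F.
move: (iF); rewrite inE => /andP[iP iF'].
exists (i |: P); split; first by rewrite subUset sub1set iF'.
  by rewrite cardsU1 iP cP.
move=> j j' jP; rewrite !inE negb_or -andbA => /and3P[j'i j'P j'F].
have j'D : j' \in F :\: P by rewrite inE j'P.
by case/setU1P: jP => [->|jP]; [exact: imin | exact: Ple].
Qed.

(** The average over P is at most the average over F, cross-multiplied to avoid empty sets in
    denominators. Once the terms in P cancel, the sums over pairs from P and F \ P compare
    termwise. *)
Lemma sum_smallest (P : {set T}) : P \subset F ->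
  (forall i i', i \in P -> i' \in F :\: P -> w i <= w i') ->
  #|F|%:R * \sum_(i in P) w i <= #|P|%:R * \sum_(i in F) w i.
Proof.
move=> PF Ple; rewrite [X in _ <= _ * X](big_setID P) /= (setIidPr PF) mulrDr.
rewrite -(cardsID P F) (setIidPr PF) natrD mulrDl lerD2l.
rewrite !mulr_natl -sumr_const -sumrMnl; apply: ler_sum => i' i'F.
by rewrite -sumr_const; apply: ler_sum => i iP; exact: Ple.
Qed.

End Smallest.

(** With c = m - l the pool has f + 1 - c jobs, and [Kconst_ge] gives c - K <= k / (k + 1 - c). What
    remains is k (f + 1 - c) <= f (k + 1 - c), that is, 0 <= (c - 1)(k - f). *)
Lemma pool_size_bound (R : realType) (m k l f : nat) :
  (0 < k)%N -> (l < m)%N -> (f <= k)%N -> (m <= l + f)%N ->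
  (1 + l + f - m)%:R * (m%:R - Kconst R m k - l%:R) <= f%:R :> R.
Proof.
move=> k0 lm fk mlf.
have [c cE] : exists c, m = (l + c)%N by exists (m - l)%N; lia.
have cm : (c <= m)%N by lia.
have ck : (c <= k)%N by lia.
have KK := @Kconst_ge R m k c k0 cm ck; rewrite /Kterm in KK.
have u0 : 0 < k%:R + 1 - c%:R :> R.
  by have : c%:R <= k%:R :> R; [rewrite ler_nat | lra].
have -> : m%:R - Kconst R m k - l%:R = c%:R - Kconst R m k :> R.
  by rewrite {1}cE natrD; ring.
apply: (@le_trans _ _ ((1 + l + f - m)%:R * (k%:R / (k%:R + 1 - c%:R)))).
  by apply: ler_wpM2l => //; lra.
rewrite mulrA ler_pdivrMr // -addrA [1 - _]addrC addrA.
have -> : k%:R - c%:R + 1 = (k + 1 - c)%:R :> R by rewrite natrB ?natrD; [ring | lia].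
by rewrite -!natrM ler_nat; nia.
Qed.

Section ScheduleTheory.
Variables (R : realType) (k n m : nat) (x : 'cV[R]_n) (t : R).
Hypotheses (m_gt0 : (0 < m)%N) (k_gt0 : (0 < k)%N).
Hypotheses (x_ge0 : forall i, 0 <= x i 0) (x_le : forall i, x i 0 <= t).
Hypothesis t_ge0 : 0 <= t.
Hypothesis sum_x : \sum_i x i 0 <= (m%:R - Kconst R m k) * t.
Hypothesis frac_k : (#|frac_jobs x t| <= k)%N.

Lemma job_cases i : [\/ x i 0 = 0, i \in full_jobs x t | i \in frac_jobs x t].
Proof.
have := x_ge0 i; rewrite le_eqVlt => /predU1P[<-|xi]; first by constructor 1.
have := x_le i; rewrite le_eqVlt => /orP[xt|xt].
  by constructor 2; rewrite inE xi.
by constructor 3; rewrite inE xi.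
Qed.

Lemma full_jobsE i : i \in full_jobs x t -> x i 0 = t.
Proof. by rewrite inE => /andP[_ /eqP]. Qed.

Lemma sum_full_frac : #|full_jobs x t|%:R * t + \sum_(i in frac_jobs x t) x i 0
  <= (m%:R - Kconst R m k) * t.
Proof.
apply: le_trans sum_x; rewrite [leRHS](bigID (mem (full_jobs x t))) /=.
apply: lerD.
  by rewrite (eq_bigr (fun=> t)) ?sumr_const ?mulr_natl // => i /full_jobsE.
rewrite [leRHS](bigID (mem (frac_jobs x t))) /= -[leLHS]addr0.
apply: lerD; last exact: sumr_ge0.
rewrite le_eqVlt; apply/orP; left; apply/eqP; apply: eq_bigl => i.
rewrite !inE; case: (x i 0 =P t) => [->|]; first by rewrite ltxx !andbF.
by rewrite andbF.
Qed.

(** A fractional job has positive length, so l t < (m - K) t <= m t; a machine is left for the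
    pool. *)
Lemma full_jobs_lt : (0 < #|frac_jobs x t|)%N -> (#|full_jobs x t| < m)%N.
Proof.
move=> /card_gt0P[i0 i0f]; have := i0f; rewrite inE => /andP[x0 xt].
have t0 := lt_trans x0 xt; have K0 := Kconst_ge0 R m_gt0 k_gt0.
have s0 : 0 < \sum_(i in frac_jobs x t) x i 0.
  by rewrite (bigD1 i0) //= ltr_pwDl // sumr_ge0.
rewrite -(ltr_nat R) -(ltr_pM2r t0).
have := sum_full_frac; have : 0 <= Kconst R m k * t by rewrite mulr_ge0.
by rewrite mulrBl; lra.
Qed.

Lemma full_jobs_le : (#|full_jobs x t| <= m)%N.
Proof.
have [->|[i0]] := set_0Vmem (full_jobs x t); first by rewrite cards0.
rewrite inE => /andP[x0 /eqP xt]; rewrite xt in x0.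
have K0 := Kconst_ge0 R m_gt0 k_gt0.
rewrite -(ler_nat R) -(ler_pM2r x0).
have := sum_full_frac; have : 0 <= Kconst R m k * t by rewrite mulr_ge0.
have : 0 <= \sum_(i in frac_jobs x t) x i 0 by apply: sumr_ge0.
by rewrite mulrBl; lra.
Qed.

(** By averaging, the pool takes at most the share #|P| / f of the fractional volume, which is at
    most (m - K - l) t; [pool_size_bound] concludes. *)
Lemma pool_sum (P : {set 'I_n}) : P \subset frac_jobs x t ->
  #|P| = pool_size x t m k ->
  (forall i i', i \in P -> i' \in frac_jobs x t :\: P -> x i 0 <= x i' 0) ->
  \sum_(i in P) x i 0 <= t.
Proof.
move=> PF cP Ple.
have [P0|/card_gt0P [i0 i0P]] := posnP #|P|.
  by rewrite (cards0_eq P0) big_set0.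
have P0 : (0 < #|P|)%N by apply/card_gt0P; exists i0.
have F0 : (0 < #|frac_jobs x t|)%N.
  by apply: leq_trans P0 _; apply: subset_leq_card.
have lm := full_jobs_lt F0; have sm := sum_smallest PF Ple.
have sff := sum_full_frac.
(* For a nonempty pool the truncated subtractions in [pool_size] are exact. *)
have mlf : (m <= #|full_jobs x t| + #|frac_jobs x t|)%N.
  by move: cP P0; rewrite /pool_size; lia.
have cPE : #|P| = (1 + #|full_jobs x t| + #|frac_jobs x t| - m)%N.
  by move: cP P0; rewrite /pool_size; lia.
have := pool_size_bound R k_gt0 lm frac_k mlf; rewrite -cPE => pb.
rewrite -(@ler_pM2l _ #|frac_jobs x t|%:R) ?ltr0n //.
apply: le_trans sm _.
apply: (@le_trans _ _ (#|P|%:R * ((m%:R - Kconst R m k - #|full_jobs x t|%:R) * t))).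
  by apply: ler_wpM2l => //; rewrite mulrBl; lra.
by rewrite mulrA ler_wpM2r.
Qed.

Lemma exists_LP_schedule : exists sigma : 'I_n -> 'I_m, LP_schedule x t k sigma.
Proof.
set F := frac_jobs x t; set L := full_jobs x t.
have [P [PF cP Ple]] : exists P : {set 'I_n}, [/\ P \subset F,
    #|P| = (if (0 < #|F|)%N then pool_size x t m k else 0%N)
  & forall i i', i \in P -> i' \in F :\: P -> x i 0 <= x i' 0].
  apply: (exists_smallest (fun i => x i 0)); case: ifP => // F0.
  have := full_jobs_lt F0; have := frac_k; rewrite /pool_size -/F -/L.
  by move: #|F| #|L| => f l; lia.
pose Q := L :|: (F :\: P).
(* Q holds the jobs that get a machine of their own; the boolean counts the machine of the pool. *)
have cQ : (#|Q| + (0 < #|F|)%N <= m)%N.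
  have cFP : #|F :\: P| = (#|F| - #|P|)%N by rewrite cardsD (setIidPr PF).
  have := (leq_card_setU L (F :\: P)).1; rewrite -/Q cFP cP.
  have := full_jobs_le; have := frac_k; rewrite /pool_size -/F -/L.
  have [F0|F0] := ltnP 0 #|F|; last by move: F0; move: #|F| #|L| #|Q| => f l q; lia.
  have := full_jobs_lt F0; rewrite -/F -/L.
  by move: F0; move: #|F| #|L| #|Q| => f l q; lia.
case: m m_gt0 cQ cP => // m' _ cQ cP.
(* index returns the size of the list on absent items: every job outside Q, hence
   the whole pool, lands on machine #|Q|. *)
pose idx i := index i (enum Q).
have idx_in i : i \in Q -> (idx i < #|Q|)%N by rewrite cardE index_mem mem_enum.
have idx_out i : i \notin Q -> idx i = #|Q|.
  by move=> iQ; rewrite cardE; apply: memNindex; rewrite mem_enum.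
have idx_inj i j : i \in Q -> idx j = idx i -> j = i.
  move=> iQ ji; have jQ : j \in Q.
    by apply: contraTT (idx_in i iQ) => /idx_out <-; rewrite ji ltnn.
  by apply: (@index_inj _ i (enum Q)) ji; rewrite mem_enum.
have small i : (0 < x i 0) -> i \notin Q -> i \in P.
  move=> xi; rewrite in_setU in_setD => /norP[]; case: (job_cases i) => [x0|->|iF] //.
    by rewrite x0 ltxx in xi.
  by move: iF; rewrite inE => -> _; rewrite andbT negbK.
have Fpos i : i \in F -> (0 < #|F|)%N by move=> iF; apply/card_gt0P; exists i.
(* [inord] is faithful on these indices: a positive job outside Q lies in the pool, so F is nonempty
   and #|Q| < m. Only jobs of length 0 can have an index out of range, and those may go anywhere. *)
have sQ i j : i \in Q -> 0 < x j 0 ->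
    inord (idx j) = inord (idx i) :> 'I_m'.+1 -> j = i.
  move=> iQ xj /(congr1 val); have iQ' := idx_in _ iQ.
  rewrite /= (inordK (m := idx i)) ?ltnS; last by lia.
  rewrite inordK => [|]; first exact: idx_inj.
  have [jQ|jQ] := boolP (j \in Q); first by have := idx_in _ jQ; lia.
  have := Fpos j (subsetP PF _ (small _ xj jQ)); rewrite idx_out //; lia.
exists (fun i => inord (idx i)); split=> [i iL i' xi'|F0].
  by apply: sQ => //; rewrite inE iL.
rewrite F0 in cP; rewrite F0 addn1 ltnS in cQ; exists P, (inord #|Q|).
have nQ i : i \in Q -> inord (idx i) <> inord #|Q| :> 'I_m'.+1.
  move=> /idx_in iQ /(congr1 val); rewrite /= !inordK ?ltnS //.
    by move=> e; rewrite e ltnn in iQ.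
  exact: leq_trans (ltnW iQ) cQ.
split=> [|//|i iP|i iL|i iFP]; first by split.
- congr inord; apply: idx_out; rewrite !inE iP /= orbF negb_and.
  by have := subsetP PF _ iP; rewrite inE => /andP[_ /lt_eqF->]; rewrite orbT.
- by apply: nQ; rewrite inE iL.
- by split=> [|i' xi']; [apply: nQ | apply: sQ => //]; rewrite inE iFP orbT.
Qed.

Lemma makespan_le (sigma : 'I_n -> 'I_m) :
  LP_schedule x t k sigma -> makespan sigma x <= t.
Proof.
move=> [aL aF]; apply: bigmax_le => // j _.
have alone_sum i : sigma i = j -> alone x sigma i -> \sum_(i | sigma i == j) x i 0 <= t.
  move=> sij ai; rewrite (bigD1 i) ?sij //= big1 ?addr0 // => i' /andP[/eqP si' ii'].
  apply/eqP; apply: contraNT ii' => xi'; apply/eqP; apply: ai; last by rewrite si'.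
  by rewrite lt_neqAle eq_sym xi' x_ge0.
have [[i [iL sij]]|nL] := pselect (exists i, i \in full_jobs x t /\ sigma i = j).
  exact: alone_sum sij (aL i iL).
have xfrac i : sigma i = j -> i \notin frac_jobs x t -> x i 0 = 0.
  by move=> sij iF; case: (job_cases i) => // [iL|];
    [case: nL; exists i | rewrite (negPf iF)].
have [F0|F0] := posnP #|frac_jobs x t|.
  rewrite big1 // => i /eqP si; apply: xfrac => //.
  by rewrite (cards0_eq F0) inE.
have [P [j0 [[PF cP] Ple Pj0 Lj0 FPj0]]] := aF F0.
have [[i [iFP sij]]|nFP] :=
  pselect (exists i, i \in frac_jobs x t :\: P /\ sigma i = j).
  exact: alone_sum sij (FPj0 i iFP).2.
(* Machine j now carries no full job and no fractional job outside P, so its load comes from P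
   alone. *)
apply: le_trans (pool_sum PF cP Ple).
rewrite [leRHS](bigID (fun i => sigma i == j)) /= -[leLHS]addr0.
apply: lerD; last exact: sumr_ge0.
rewrite big_mkcond [leRHS]big_mkcond /=; apply: ler_sum => i _.
case: eqP => [si|]; rewrite ?andbF //= andbT; case: ifP => // iP.
rewrite xfrac //; apply/negP => iF; apply: nFP; exists i; split=> //.
by rewrite inE iP.
Qed.

End ScheduleTheory.

(** The algorithm leaves choices open, so the bounds cover every optimal basic solution and every
    schedule obeying the rule, next to the existence of both. *)
Theorem theorem7 (R : realType) (m k n : nat)
    (A : 'M[R]_(k, n)) (b : 'cV[R]_k)
    (m_gt0 : (0 < m)%N) (k_gt0 : (0 < k)%N)
    (feas : exists x : 'cV[R]_n, SLC_feasible A b x) :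
  (exists (x : 'cV[R]_n) (t : R), LP7_optimal_bfs A b m x t) /\
  (forall (x : 'cV[R]_n) (t : R), LP7_optimal_bfs A b m x t ->
     (exists sigma : 'I_n -> 'I_m, LP_schedule x t k sigma) /\
     (forall sigma : 'I_n -> 'I_m, LP_schedule x t k sigma ->
        [/\ SLC_feasible A b x,
            makespan sigma x <= t
          & t <= m%:R / (m%:R - Kconst R m k) * opt_makespan A b m])).
Proof.
split; first exact: exists_LP7_optimal_bfs.
move=> x t bfs; have frac_k := frac_jobs_card bfs.
have [[feas_xt _] _] := bfs; have [Ax sx xt x0] := feas_xt.
have t0 := LP7_feasible_t_ge0 k_gt0 feas_xt.
split=> [|sigma sched]; first exact: exists_LP_schedule.
split=> //; first exact: makespan_le sched.
exact: (LP7_optimal_le m_gt0 k_gt0 bfs.1 feas).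
Qed.
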